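(* Let $(\mathfrak{g},[\cdot,\cdot]_{\mathfrak{g}},B)$ be a Rota-Baxter Lie algebra of weight $1$ and let $\phi:(\mathfrak{g},[\cdot,\cdot]_B)\to\mathfrak{X}(M)$ be an action of it on a manifold $M$. Let $\mathcal{A}:=(M\times\mathfrak{g})\oplus TM$ be the Lie algebroid over $M$ whose anchor $a_{\mathcal{A}}$ is the projection to $TM$ and whose bracket is determined by $$[fu+X,gv+Y]_{\mathcal{A}}:=fg[u,v]_{\mathfrak{g}}+X(g)v-Y(f)u+[X,Y]_{TM}$$ for all $X,Y\in\mathfrak{X}(M)$, $u,v\in\mathfrak{g}$, $f,g\in C^\infty(M)$. Then the bundle map $\mathcal{B}:\ker(a_{\mathcal{A}})=M\times\mathfrak{g}\to(M\times\mathfrak{g})\oplus TM$ defined by $\mathcal{B}(m,u):=(m,B(u),\phi(u)(m))$ for $m\in M$, $u\in\mathfrak{g}$, is a Rota-Baxter operator of weight $1$ on the Lie algebroid $((M\times\mathfrak{g})\oplus TM,[\cdot,\cdot]_{\mathcal{A}},a_{\mathcal{A}})$.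
   Context: A Rota-Baxter Lie algebra of weight $1$ is a Lie algebra with a linear map $B$ such that $[B(u),B(v)]_{\mathfrak{g}}=B([B(u),v]_{\mathfrak{g}}+[u,B(v)]_{\mathfrak{g}}+[u,v]_{\mathfrak{g}})$ for all $u,v$. Then $[u,v]_B:=[B(u),v]_{\mathfrak{g}}+[u,B(v)]_{\mathfrak{g}}+[u,v]_{\mathfrak{g}}$ is another Lie bracket on $\mathfrak{g}$. An action of $(\mathfrak{g},[\cdot,\cdot]_{\mathfrak{g}},B)$ on a manifold $M$ is a Lie algebra homomorphism $\phi:(\mathfrak{g},[\cdot,\cdot]_B)\to\mathfrak{X}(M)$ to vector fields. A Lie algebroid structure on a vector bundle $\mathcal{A}\to M$ is a Lie bracket on $\Gamma(\mathcal{A})$ and a vector bundle morphism $a_{\mathcal{A}}:\mathcal{A}\to TM$ with $[x,fy]_{\mathcal{A}}=f[x,y]_{\mathcal{A}}+a_{\mathcal{A}}(x)(f)y$; it is transitive if $a_{\mathcal{A}}$ is surjective. A Rota-Baxter operator of weight $\lambda$ on a transitive Lie algebroid is a vector bundle map $\mathcal{B}:\ker(a_{\mathcal{A}})\to\mathcal{A}$ covering the identity such that $[\mathcal{B}(u),\mathcal{B}(v)]_{\mathcal{A}}=\mathcal{B}([\mathcal{B}(u),v]_{\mathcal{A}})+\mathcal{B}([u,\mathcal{B}(v)]_{\mathcal{A}})+\lambda\mathcal{B}([u,v]_{\mathcal{A}})$ for all $u,v\in\Gamma(\ker(a_{\mathcal{A}}))$. Here $\Gamma(\mathcal{A})=(C^\infty(M)\otimes\mathfrak{g})\oplus\mathfrak{X}(M)$.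 *)

(* Defs.v *)
From HB Require Import structures.
From mathcomp Require Import all_boot all_order all_algebra.
From mathcomp Require Import all_classical all_reals all_analysis.
From mathcomp Require Import ring.
Set Implicit Arguments.
Unset Strict Implicit.
Unset Printing Implicit Defensive.
Import Order.TTheory GRing.Theory Num.Theory.
Import numFieldNormedType.Exports.
Local Open Scope classical_set_scope.
Local Open Scope ring_scope.

Section smooth_calculus.
Context {R : realType} {n : nat}.
Implicit Types (U : set 'rV[R]_n) (f g : 'rV[R]_n -> R).

(* C^k on an open set U, through iterated partial derivatives; only the values
   of f on U matter. *)
Fixpoint Ck (k : nat) U f : Prop :=
  (forall x, U x -> {for x, continuous f}) /\
  (if k is k'.+1 then
     forall i : 'I_n,
       (forall x, U x -> derivable f x (delta_mx 0 i)) /\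
       Ck k' U ('D_(delta_mx 0 i) f)
   else True).

Definition smooth_on U f : Prop := forall k, Ck k U f.

Lemma Ck_ext k U f g : open U -> {in U, f =1 g} -> Ck k U f -> Ck k U g.
Proof.
move=> oU; elim: k f g => [|k IH] f g fg /= [cf df].
all: have nfg x : U x -> \near x, f x = g x by move=> Ux;
  apply: filterS (open_nbhs_nbhs (conj oU Ux)) => y Uy; apply: fg; rewrite inE.
all: have cg x : U x -> {for x, continuous g} by
  move=> Ux; rewrite /prop_for /continuous_at -(nbhs_singleton (nfg _ Ux));
  apply: cvg_trans (cf _ Ux); exact: (@near_eq_cvg _ _ (nbhs x) _ _ _ (nfg _ Ux)).
  by [].
split=> // i.
have [di Ci] := df i; split=> [x Ux|].
  by apply: near_eq_derivable (di _ Ux); exact: nfg.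
apply: IH Ci => x; rewrite inE => Ux; apply: near_eq_derive; exact: nfg.
Qed.

Lemma Ck_cst k U (a : R) : Ck k U (cst a).
Proof.
elim: k a => [|k IH] a /=; (split; first by move=> x _; exact: cst_continuous) => //.
move=> i; split; first by move=> x _; exact: derivable_cst.
have -> : 'D_(delta_mx 0 i) (cst a) = cst 0 :> ('rV[R]_n -> R).
  by apply/funext => x; rewrite derive_cst.
exact: IH.
Qed.

Lemma CkW k U f : Ck k.+1 U f -> Ck k U f.
Proof.
elim: k f => [|k IH] f; first by move=> /= [].
move=> [cf df]; split=> // i; have [di Ci] := df i; split=> //.
exact: IH.
Qed.

Lemma CkD k U f g : open U -> Ck k U f -> Ck k U g -> Ck k U (f \+ g).
Proof.
move=> oU; elim: k f g => [|k IH] f g /= [cf df] [cg dg].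
  by split=> // x Ux; exact: continuousD (cf _ Ux) (cg _ Ux).
split=> [x Ux|i]; first exact: continuousD (cf _ Ux) (cg _ Ux).
have [di Ci] := df i; have [di' Ci'] := dg i; split=> [x Ux|].
  by apply: derivableD; [exact: di|exact: di'].
apply: Ck_ext (IH _ _ Ci Ci') => // x; rewrite inE => Ux /=.
by rewrite [RHS]deriveD //; [exact: di|exact: di'].
Qed.

Lemma CkM k U f g : open U -> Ck k U f -> Ck k U g -> Ck k U (f \* g).
Proof.
move=> oU; elim: k f g => [|k IH] f g Hf Hg.
  move: Hf Hg => /= [cf df] [cg dg].
  by split=> // x Ux; exact: continuousM (cf _ Ux) (cg _ Ux).
have Hf' := CkW Hf; have Hg' := CkW Hg.
move: Hf Hg => /= [cf df] [cg dg].
split=> [x Ux|i]; first exact: continuousM (cf _ Ux) (cg _ Ux).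
have [di Ci] := df i; have [di' Ci'] := dg i; split=> [x Ux|].
  by apply: derivableM; [exact: di|exact: di'].
apply: Ck_ext (CkD oU (IH _ _ Hf' Ci') (IH _ _ Hg' Ci)) => // x.
rewrite inE => Ux /=.
by rewrite [RHS]deriveM //; [exact: di|exact: di'].
Qed.

End smooth_calculus.

(* [chart_inv] is total: only its values on the image of the domain matter. *)
Record chart (R : realType) (n : nat) (M : topologicalType) := Chart {
  chart_dom : set M ;
  chart_map :> M -> 'rV[R]_n ;
  chart_inv : 'rV[R]_n -> M ;
  chart_dom_open : open chart_dom ;
  chart_img_open : open (chart_map @` chart_dom) ;
  chart_mapK : {in chart_dom, cancel chart_map chart_inv} ;
  chart_map_continuous :
    forall m, chart_dom m -> {for m, continuous chart_map} ;
  chart_inv_continuous :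
    forall x, (chart_map @` chart_dom) x -> {for x, continuous chart_inv} }.

(* The atlas is not required to be maximal: any smooth atlas determines the
   smooth structure, and the notions below depend only on that structure. *)
Record manifold (R : realType) (n : nat) := Manifold {
  manifold_space :> topologicalType ;
  manifold_hausdorff : hausdorff_space manifold_space ;
  manifold_countable : @second_countable manifold_space ;
  atlas : set (chart R n manifold_space) ;
  atlas_cover : forall m, exists2 c, atlas c & chart_dom c m ;
  atlas_compat : forall c c', atlas c -> atlas c' -> forall i : 'I_n,
    smooth_on (c @` (chart_dom c `&` chart_dom c'))
              (fun x => c' (chart_inv c x) 0 i) }.

Section smooth_functions.
Context {R : realType} {n : nat} (M : manifold R n).

Definition smooth (f : M -> R) : Prop := forall c, atlas c ->
  smooth_on (c @` chart_dom c) (f \o chart_inv c).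

Lemma smooth_cst (a : R) : smooth (cst a).
Proof. by move=> c _ k; exact: Ck_cst. Qed.

Lemma smoothD f g : smooth f -> smooth g -> smooth (f \+ g).
Proof.
by move=> hf hg c Ac k; apply: CkD; [exact: chart_img_open|exact: hf|exact: hg].
Qed.

Lemma smoothM f g : smooth f -> smooth g -> smooth (f \* g).
Proof.
by move=> hf hg c Ac k; apply: CkM; [exact: chart_img_open|exact: hf|exact: hg].
Qed.

Definition smooth_pred : {pred (M -> R)} := fun f => `[< smooth f >].

Lemma smooth_subring : subring_closed smooth_pred.
Proof.
split=> [|f g /asboolP hf /asboolP hg|f g /asboolP hf /asboolP hg]; apply/asboolP.
- exact: smooth_cst.
- rewrite (_ : f - g = f \+ (cst (-1) \* g)); last first.
    by apply/funext => m /=; rewrite mulN1r.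
  by apply: smoothD => //; apply: smoothM => //; exact: smooth_cst.
- exact: smoothM.
Qed.

HB.instance Definition _ := GRing.isSubringClosed.Build _ smooth_pred smooth_subring.

Lemma smooth_scale : GRing.scaler_closed smooth_pred.
Proof.
move=> a f /asboolP hf; apply/asboolP.
by apply: (@smoothM (cst a)) => //; exact: smooth_cst.
Qed.

HB.instance Definition _ := GRing.isScaleClosed.Build R (M -> R) smooth_pred smooth_scale.

Record smoothfun := SmoothFun {
  smoothfun_val :> M -> R ;
  smoothfunP : smoothfun_val \in smooth_pred }.

HB.instance Definition _ := [isSub for smoothfun_val].
HB.instance Definition _ := [Choice of smoothfun by <:].
HB.instance Definition _ := 
  GRing.SubChoice_isSubComPzRing.Build (M -> R) smooth_pred smoothfun smooth_subring.
HB.instance Definition _ := [SubZmodule_isSubLmodule of smoothfun by <:].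

End smooth_functions.

Section tangent_spaces.
Context {R : realType} {n : nat} (M : manifold R n).
Local Notation Cinf := (smoothfun M).

Lemma smoothfunD (f g : Cinf) m : (f + g) m = f m + g m.
Proof. by []. Qed.
Lemma smoothfunB (f g : Cinf) m : (f - g) m = f m - g m.
Proof. by []. Qed.
Lemma smoothfunM (f g : Cinf) m : (f * g) m = f m * g m.
Proof. by []. Qed.
Lemma smoothfunZ (a : R) (f : Cinf) m : (a *: f) m = a * f m.
Proof. by []. Qed.

Definition derivation_at (m : M) (D : Cinf -> R) : Prop :=
  (forall (a : R) (f g : Cinf), D (a *: f + g) = a * D f + D g) /\
  (forall f g : Cinf, D (f * g) = f m * D g + g m * D f).

Definition derivation_pred (m : M) : {pred (Cinf -> R)} :=
  fun D => `[< derivation_at m D >].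

Lemma derivation_submod m : GRing.submod_closed (derivation_pred m).
Proof.
split=> [|b D1 D2 /asboolP[l1 d1] /asboolP[l2 d2]]; apply/asboolP; split.
- by move=> a f g; rewrite /= mulr0 addr0.
- by move=> f g; rewrite /= !mulr0 addr0.
- move=> a f g; rewrite !fctE /= l1 l2 /GRing.scale /=; ring.
- move=> f g; rewrite !fctE /= d1 d2 /GRing.scale /=; ring.
Qed.

HB.instance Definition _ m :=
  GRing.isSubmodClosed.Build R (Cinf -> R) (derivation_pred m)
    (derivation_submod m).

(* Tangent vectors at m are the derivations of C^oo(M) at m. *)
Record tangent (m : M) := Tangent {
  tangent_val :> Cinf -> R ;
  tangentP : tangent_val \in derivation_pred m }.

HB.instance Definition _ m := [isSub for @tangent_val m].
HB.instance Definition _ m := [Choice of tangent m by <:].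
HB.instance Definition _ m := [SubChoice_isSubZmodule of tangent m by <:].
HB.instance Definition _ m := [SubZmodule_isSubLmodule of tangent m by <:].

End tangent_spaces.

Section vector_bundles.
Context {R : realType} {n : nat} (M : manifold R n).

(* A smooth vector bundle over M is presented by its fibers and by which of its
   sections are smooth (a C^oo(M)-submodule). Local triviality is not recorded:
   the bundles built below, M x g, TM, their direct sum and the kernel of the
   projection to TM, are the usual vector bundles with their usual smooth
   sections, and no construction on bundles below uses local frames. *)
Record vbundle := VBundle {
  fiber :> M -> lmodType R ;
  smooth_section : (forall m, fiber m) -> Prop ;
  smooth_section0 : smooth_section (fun=> 0) ;
  smooth_sectionD : forall s t, smooth_section s -> smooth_section t ->
    smooth_section (fun m => s m + t m) ;
  smooth_sectionZ : forall (f : smoothfun M) s, smooth_section s ->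
    smooth_section (fun m => f m *: s m) }.

Record section (E : vbundle) := Section {
  section_val :> forall m, E m ;
  sectionP : smooth_section section_val }.

Lemma section_ext (E : vbundle) (s t : section E) : (forall m, s m = t m) -> s = t.
Proof.
case: s t => [s hs] [t ht] /= st.
have {}st : s = t by apply: functional_extensionality_dep.
by subst t; congr Section; exact: Prop_irrelevance.
Qed.

Lemma smooth_cst_in (a : R) : (cst a : M -> R) \in @smooth_pred _ _ M.
Proof. apply/asboolP; exact: smooth_cst. Qed.
Definition smoothfun_cst (a : R) : smoothfun M := SmoothFun (smooth_cst_in a).

Section section_module.
Variable E : vbundle.
Implicit Types s t : section E.

Definition section0 : section E := Section (smooth_section0 E).
Definition sectionD s t : section E := Section (smooth_sectionD (sectionP s) (sectionP t)).
Definition section_mul (f : smoothfun M) s : section E :=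
  Section (smooth_sectionZ f (sectionP s)).
Definition sectionZ (a : R) s : section E := section_mul (smoothfun_cst a) s.
Definition sectionN s : section E := sectionZ (-1) s.

Let sectionA : associative sectionD.
Proof. by move=> s t u; apply: section_ext => m /=; rewrite addrA. Qed.
Let sectionC : commutative sectionD.
Proof. by move=> s t; apply: section_ext => m /=; rewrite addrC. Qed.
Let section0D : left_id section0 sectionD.
Proof. by move=> s; apply: section_ext => m /=; rewrite add0r. Qed.
Let sectionND : left_inverse section0 sectionN sectionD.
Proof. by move=> s; apply: section_ext => m /=; rewrite scaleN1r addNr. Qed.

HB.instance Definition _ := gen_eqMixin (section E).
HB.instance Definition _ := gen_choiceMixin (section E).
HB.instance Definition _ :=
  GRing.isZmodule.Build (section E) sectionA sectionC section0D sectionND.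

Let sectionZA a b s : sectionZ a (sectionZ b s) = sectionZ (a * b) s.
Proof. by apply: section_ext => m /=; rewrite scalerA. Qed.
Let section1Z : left_id 1 sectionZ.
Proof. by move=> s; apply: section_ext => m /=; rewrite scale1r. Qed.
Let sectionZD : right_distributive sectionZ +%R.
Proof. by move=> a s t; apply: section_ext => m /=; rewrite scalerDr. Qed.
Let sectionDZ s : {morph sectionZ^~ s : a b / a + b}.
Proof. by move=> a b; apply: section_ext => m /=; rewrite scalerDl. Qed.

HB.instance Definition _ := GRing.Zmodule_isLmodule.Build R (section E)
  sectionZA section1Z sectionZD sectionDZ.

Lemma section_addE s t m : (s + t) m = s m + t m. Proof. by []. Qed.
Lemma section_zeroE m : (0 : section E) m = 0. Proof. by []. Qed.
Lemma section_oppE s m : (- s) m = - s m.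
Proof. by rewrite -[RHS]scaleN1r. Qed.
Lemma section_subE s t m : (s - t) m = s m - t m.
Proof. by rewrite section_addE section_oppE. Qed.
Lemma section_scaleE a s m : (a *: s) m = a *: s m. Proof. by []. Qed.

End section_module.

(* Vector bundle morphisms covering the identity: fiberwise linear and smooth,
   smoothness being that smooth sections are sent to smooth sections. *)
Record bundle_map (E F : vbundle) := BundleMap {
  bundle_map_val :> forall m, {linear E m -> F m} ;
  bundle_mapP : forall s, smooth_section s ->
    smooth_section (fun m => bundle_map_val m (s m)) }.

Definition bundle_map_section E F (a : bundle_map E F) (s : section E) : section F :=
  Section (bundle_mapP a (sectionP s)).

(* A vector field is smooth iff it maps C^oo(M) to C^oo(M). *)
Definition smooth_vf (X : forall m, tangent m) : Prop :=
  forall f : smoothfun M, smooth (fun m => X m f).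

Fact smooth_vf0 : smooth_vf (fun=> 0).
Proof. by move=> f; exact: (@smooth_cst _ _ M 0). Qed.
Fact smooth_vfD X Y : smooth_vf X -> smooth_vf Y -> smooth_vf (fun m => X m + Y m).
Proof. by move=> hX hY f; exact: smoothD (hX f) (hY f). Qed.
Fact smooth_vfZ (g : smoothfun M) X : smooth_vf X -> smooth_vf (fun m => g m *: X m).
Proof. by move=> hX f; exact: smoothM (asboolP _ (smoothfunP g)) (hX f). Qed.

Definition tangent_bundle : vbundle :=
  @VBundle (fun m => tangent m : lmodType R) smooth_vf smooth_vf0 smooth_vfD smooth_vfZ.

Section trivial.
Variable g : vectType R.

(* [g] is finite-dimensional; smoothness of M -> g is read off in a basis. *)
Definition smooth_vect (s : M -> g) : Prop :=
  forall i, smooth (fun m => coord (vbasis (fullv : {vspace g})) i (s m)).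

Fact smooth_vect0 : smooth_vect (fun=> 0).
Proof. by move=> i; rewrite (_ : (fun=> _) = cst 0) ?linear0; [exact: smooth_cst|]. Qed.
Fact smooth_vectD s t : smooth_vect s -> smooth_vect t -> smooth_vect (fun m => s m + t m).
Proof.
move=> hs ht i; have := smoothD (hs i) (ht i).
by congr smooth; apply/funext => m /=; rewrite linearD.
Qed.
Fact smooth_vectZ (f : smoothfun M) s : smooth_vect s -> smooth_vect (fun m => f m *: s m).
Proof.
move=> hs i; have := smoothM ((asboolP _ (smoothfunP f))) (hs i).
by congr smooth; apply/funext => m /=; rewrite linearZ.
Qed.

Definition trivial_bundle : vbundle :=
  @VBundle (fun _ => g : lmodType R) smooth_vect smooth_vect0 smooth_vectD smooth_vectZ.

End trivial.

Section direct_sum.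
Variables E F : vbundle.

Definition smooth_pair (s : forall m, (E m * F m)%type) : Prop :=
  smooth_section (fun m => (s m).1) /\ smooth_section (fun m => (s m).2).

Fact smooth_pair0 : smooth_pair (fun=> 0).
Proof. by split; exact: smooth_section0. Qed.
Fact smooth_pairD s t : smooth_pair s -> smooth_pair t -> smooth_pair (fun m => s m + t m).
Proof. by move=> [s1 s2] [t1 t2]; split; exact: smooth_sectionD. Qed.
Fact smooth_pairZ (f : smoothfun M) s : smooth_pair s -> smooth_pair (fun m => f m *: s m).
Proof. by move=> [s1 s2]; split; exact: smooth_sectionZ. Qed.

Definition dsum_bundle : vbundle :=
  @VBundle (fun m => (E m * F m)%type : lmodType R) smooth_pair
    smooth_pair0 smooth_pairD smooth_pairZ.

Definition snd_lin m : {linear (E m * F m)%type -> F m} := snd.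
Definition dsum_snd : bundle_map dsum_bundle F :=
  @BundleMap dsum_bundle F snd_lin (fun s hs => proj2 hs).
End direct_sum.

End vector_bundles.

Record is_lie_bracket (R : realType) (V : lmodType R) (br : V -> V -> V) : Prop :=
  IsLieBracket {
    lie_linearl : forall (a : R) u v w, br (a *: u + v) w = a *: br u w + br v w ;
    lie_linearr : forall (a : R) u v w, br w (a *: u + v) = a *: br w u + br w v ;
    lie_alt : forall u, br u u = 0 ;
    lie_jacobi : forall u v w,
      br u (br v w) + br v (br w u) + br w (br u v) = 0 }.

Definition is_lie_morphism (R : realType) (V W : lmodType R)
    (brV : V -> V -> V) (brW : W -> W -> W) (f : {linear V -> W}) : Prop :=
  forall u v, f (brV u v) = brW (f u) (f v).

Section lie_bracket_theory.
Context {R : realType} {V : lmodType R} {br : V -> V -> V}.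
Hypothesis brP : is_lie_bracket br.

Lemma lieDl u v w : br (u + v) w = br u w + br v w.
Proof. by have := lie_linearl brP 1 u v w; rewrite !scale1r. Qed.
Lemma lieDr u v w : br w (u + v) = br w u + br w v.
Proof. by have := lie_linearr brP 1 u v w; rewrite !scale1r. Qed.
Lemma lie0l w : br 0 w = 0.
Proof. by apply: (addIr (br 0 w)); rewrite -lieDl !add0r. Qed.
Lemma lie0r w : br w 0 = 0.
Proof. by apply: (addIr (br w 0)); rewrite -lieDr !add0r. Qed.
Lemma lieZl a u w : br (a *: u) w = a *: br u w.
Proof. by have := lie_linearl brP a u 0 w; rewrite !addr0 lie0l addr0. Qed.
Lemma lieZr a u w : br w (a *: u) = a *: br w u.
Proof. by have := lie_linearr brP a u 0 w; rewrite !addr0 lie0r addr0. Qed.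
Lemma lieNl u w : br (- u) w = - br u w.
Proof. by rewrite -scaleN1r lieZl scaleN1r. Qed.
Lemma lieNr u w : br w (- u) = - br w u.
Proof. by rewrite -scaleN1r lieZr scaleN1r. Qed.
Lemma lie_anti u v : br u v = - br v u.
Proof.
apply/eqP; rewrite -addr_eq0; apply/eqP.
by have := lie_alt brP (u + v); rewrite lieDl !lieDr !(lie_alt brP) add0r addr0.
Qed.
Lemma lie_suml I (r : seq I) (F : I -> V) w :
  br (\sum_(i <- r) F i) w = \sum_(i <- r) br (F i) w.
Proof. by elim/big_rec2: _ => [|i x y _ <-]; [exact: lie0l|exact: lieDl]. Qed.
Lemma lie_sumr I (r : seq I) (F : I -> V) w :
  br w (\sum_(i <- r) F i) = \sum_(i <- r) br w (F i).
Proof. by elim/big_rec2: _ => [|i x y _ <-]; [exact: lie0r|exact: lieDr]. Qed.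
End lie_bracket_theory.

Section rota_baxter_lie_algebra.
Context {R : realType} {g : lmodType R}.

Definition rb_bracket (br : g -> g -> g) (B : g -> g) (u v : g) : g :=
  br (B u) v + br u (B v) + br u v.

(* Weight 1. *)
Definition is_rota_baxter (br : g -> g -> g) (B : {linear g -> g}) : Prop :=
  forall u v, br (B u) (B v) = B (rb_bracket br B u v).
End rota_baxter_lie_algebra.

Section vector_fields.
Context {R : realType} {n : nat} {M : manifold R n}.
Local Notation Cinf := (smoothfun M).
Local Notation XM := (section (tangent_bundle M)).
Implicit Types (f h : Cinf) (X Y Z : XM).

Lemma tangent_derivation (m : M) (v : tangent m) : derivation_at m v.
Proof. exact: (asboolP _ (tangentP v)). Qed.

Lemma tangent_ext (m : M) (v w : tangent m) : (forall f, v f = w f) -> v = w.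
Proof. by move=> vw; apply: val_inj; apply/funext. Qed.

Lemma tangentL (m : M) (v : tangent m) (a : R) f h : v (a *: f + h) = a * v f + v h.
Proof. by have [H _] := tangent_derivation v. Qed.
Lemma tangentM (m : M) (v : tangent m) f h : v (f * h) = f m * v h + h m * v f.
Proof. by have [_ H] := tangent_derivation v. Qed.
Lemma tangentD (m : M) (v : tangent m) f h : v (f + h) = v f + v h.
Proof. by have := tangentL v 1 f h; rewrite scale1r mul1r. Qed.
Lemma tangent0 (m : M) (v : tangent m) : v 0 = 0.
Proof. by apply: (addIr (v 0)); rewrite -tangentD !add0r. Qed.
Lemma tangentZ (m : M) (v : tangent m) (a : R) f : v (a *: f) = a * v f.
Proof. by have := tangentL v a f 0; rewrite !addr0 tangent0 addr0. Qed.
Lemma tangentB (m : M) (v : tangent m) f h : v (f - h) = v f - v h.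
Proof. by rewrite -scaleN1r tangentD tangentZ mulN1r. Qed.
Lemma tangent_sum (m : M) (v : tangent m) I (r : seq I) (F : I -> Cinf) :
  v (\sum_(i <- r) F i) = \sum_(i <- r) v (F i).
Proof. by elim/big_rec2: _ => [|i x y _ <-]; [exact: tangent0|exact: tangentD]. Qed.

Fact vf_app_subproof X f : (fun m => X m f) \in @smooth_pred _ _ M.
Proof. by apply/asboolP; exact: (sectionP X). Qed.
Definition vf_app X f : Cinf := SmoothFun (vf_app_subproof X f).

Lemma smoothfun_ext f h : (forall m, f m = h m) -> f = h.
Proof. by move=> fh; apply: val_inj; apply/funext. Qed.

Lemma vf_appL X a f h : vf_app X (a *: f + h) = a *: vf_app X f + vf_app X h.
Proof. by apply: smoothfun_ext => m; exact: tangentL. Qed.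
Lemma vf_appM X f h : vf_app X (f * h) = f * vf_app X h + h * vf_app X f.
Proof. by apply: smoothfun_ext => m; exact: tangentM. Qed.
Lemma vf_appB X f h : vf_app X (f - h) = vf_app X f - vf_app X h.
Proof. by apply: smoothfun_ext => m; exact: tangentB. Qed.

Fact vf_bracket_derivation X Y m :
  (fun f => X m (vf_app Y f) - Y m (vf_app X f)) \in derivation_pred m.
Proof.
apply/asboolP; split=> [a f h|f h].
  by rewrite !vf_appL !tangentL; ring.
by rewrite !vf_appM !tangentD !tangentM /=; ring.
Qed.

Fact vf_bracket_smooth X Y :
  smooth_section (v := tangent_bundle M)
    (fun m => Tangent (vf_bracket_derivation X Y m)).
Proof.
move=> f; apply/asboolP.
exact: (smoothfunP (vf_app X (vf_app Y f) - vf_app Y (vf_app X f))).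
Qed.

Definition vf_bracket X Y : XM := Section (vf_bracket_smooth X Y).

Lemma vf_bracketE X Y m f :
  vf_bracket X Y m f = X m (vf_app Y f) - Y m (vf_app X f).
Proof. by []. Qed.

Lemma vf_app_bracket X Y f :
  vf_app (vf_bracket X Y) f = vf_app X (vf_app Y f) - vf_app Y (vf_app X f).
Proof. exact: smoothfun_ext. Qed.

Lemma vf_app_lin a X Y f : vf_app (a *: X + Y) f = a *: vf_app X f + vf_app Y f.
Proof. exact: smoothfun_ext. Qed.

Lemma vf_bracket_lie : is_lie_bracket vf_bracket.
Proof.
split=> [a X Y Z|a X Y Z|X|X Y Z]; apply: section_ext => m; apply: tangent_ext => f.
- rewrite /= !vf_app_lin tangentL !fctE /= /GRing.scale /=; ring.
- rewrite /= !vf_app_lin tangentL !fctE /= /GRing.scale /=; ring.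
- by rewrite /= subrr.
- have E (v w u : tangent m) : (v + w + u) f = v f + w f + u f by [].
  rewrite !section_addE E !vf_bracketE !vf_app_bracket !tangentB.
  by rewrite [RHS](_ : _ = 0 :> R) //; ring.
Qed.

End vector_fields.

Section lie_algebroids.
Context {R : realType} {n : nat} (M : manifold R n).

(* [la_anchor_bracket] is usually derived from the Leibniz rule; as is common,
   it is kept among the axioms. It makes the kernel of the anchor an ideal. *)
Record lie_algebroid := LieAlgebroid {
  la_bundle :> vbundle M ;
  la_bracket : section la_bundle -> section la_bundle -> section la_bundle ;
  la_anchor : bundle_map la_bundle (tangent_bundle M) ;
  la_lie : is_lie_bracket la_bracket ;
  la_leibniz : forall x (f : smoothfun M) y,
    la_bracket x (section_mul f y) =
    section_mul f (la_bracket x y) +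
    section_mul (vf_app (bundle_map_section la_anchor x) f) y ;
  la_anchor_bracket : forall x y,
    bundle_map_section la_anchor (la_bracket x y) =
    vf_bracket (bundle_map_section la_anchor x) (bundle_map_section la_anchor y) }.

Record transitive_lie_algebroid := TransitiveLieAlgebroid {
  tla_lie_algebroid :> lie_algebroid ;
  tla_transitive : forall m (v : tangent m),
    exists e, la_anchor tla_lie_algebroid m e = v }.

Section kernel.
Variables (E F : vbundle M) (a : bundle_map E F).

Definition ker_pred m : {pred E m} := fun e => a m e == 0.

Lemma ker_submod m : GRing.submod_closed (@ker_pred m).
Proof.
split=> [|b x y /eqP hx /eqP hy]; apply/eqP; first exact: linear0.
by rewrite linearP hx hy scaler0 addr0.
Qed.

HB.instance Definition _ m :=
  GRing.isSubmodClosed.Build R (E m) (@ker_pred m) (@ker_submod m).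

Record ker_fiber (m : M) := KerFiber {
  ker_val :> E m ;
  ker_valP : ker_val \in @ker_pred m }.

HB.instance Definition _ m := [isSub for @ker_val m].
HB.instance Definition _ m := [Choice of ker_fiber m by <:].
HB.instance Definition _ m := [SubChoice_isSubZmodule of ker_fiber m by <:].
HB.instance Definition _ m := [SubZmodule_isSubLmodule of ker_fiber m by <:].

Definition ker_smooth (s : forall m, ker_fiber m) : Prop :=
  smooth_section (fun m => ker_val (s m)).

Fact ker_smooth0 : ker_smooth (fun=> 0).
Proof. exact: (smooth_section0 E). Qed.
Fact ker_smoothD s t :
  ker_smooth s -> ker_smooth t -> ker_smooth (fun m => s m + t m).
Proof. exact: smooth_sectionD. Qed.
Fact ker_smoothZ (f : smoothfun M) s :
  ker_smooth s -> ker_smooth (fun m => f m *: s m).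
Proof. exact: smooth_sectionZ. Qed.

Definition ker_bundle : vbundle M :=
  @VBundle _ _ M (fun m => ker_fiber m : lmodType R) ker_smooth
    ker_smooth0 ker_smoothD ker_smoothZ.

Definition ker_incl (s : section ker_bundle) : section E :=
  @Section _ _ M E (fun m => ker_val (s m)) (sectionP s).

Fact ker_section_subproof (s : section E) :
  bundle_map_section a s = 0 -> forall m, s m \in @ker_pred m.
Proof. by move=> as0 m; apply/eqP; have := congr1 (fun t : section F => t m) as0. Qed.

Definition ker_section (s : section E) (as0 : bundle_map_section a s = 0) :
    section ker_bundle :=
  @Section _ _ M ker_bundle (fun m => KerFiber (ker_section_subproof as0 m))
    (sectionP s).

Lemma ker_incl0 (s : section ker_bundle) : bundle_map_section a (ker_incl s) = 0.
Proof. by apply: section_ext => m; apply/eqP; exact: ker_valP. Qed.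

End kernel.

Section rota_baxter_operator.
Variable A : transitive_lie_algebroid.
Local Notation a := (la_anchor A).
Local Notation K := (ker_bundle a).

Fact ker_bracketl_subproof (x : section A) (u : section K) :
  bundle_map_section a (la_bracket x (ker_incl u)) = 0.
Proof. by rewrite la_anchor_bracket ker_incl0 (lie0r (@vf_bracket_lie _ _ M)). Qed.

Fact ker_bracketr_subproof (u : section K) (x : section A) :
  bundle_map_section a (la_bracket (ker_incl u) x) = 0.
Proof. by rewrite la_anchor_bracket ker_incl0 (lie0l (@vf_bracket_lie _ _ M)). Qed.

Definition ker_bracketl x u : section K := ker_section (ker_bracketl_subproof x u).
Definition ker_bracketr u x : section K := ker_section (ker_bracketr_subproof u x).

(* The three brackets on the right-hand side are sections of the kernel of the
   anchor, so that B applies to them. *)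
Definition is_rota_baxter_operator (lambda : R) (B : bundle_map K A) : Prop :=
  forall u v : section K,
    let Bs := bundle_map_section B in
    la_bracket (Bs u) (Bs v) =
    Bs (ker_bracketl (Bs u) v) + Bs (ker_bracketr u (Bs v)) +
    lambda *: Bs (ker_bracketl (ker_incl u) v).

End rota_baxter_operator.

End lie_algebroids.

Section trivial_algebroid.
Context {R : realType} {n : nat} (M : manifold R n).
Variables (g : vectType R) (br : g -> g -> g).
Hypothesis brP : is_lie_bracket br.
Local Notation Cinf := (smoothfun M).
Local Notation XM := (section (tangent_bundle M)).
Local Notation Tg := (trivial_bundle M g).
Local Notation d := (\dim (fullv : {vspace g})).
Local Notation e_ := (vbasis (fullv : {vspace g})).
Local Notation co := (coord (vbasis (fullv : {vspace g}))).

Lemma co_ext (u v : g) : (forall i, co i u = co i v) -> u = v.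
Proof.
move=> uv; rewrite (coord_vbasis (memvf u)) (coord_vbasis (memvf v)).
by apply: eq_bigr => i _; rewrite uv.
Qed.

Lemma co_basis (i j : 'I_d) : co i e_`_j = (i == j)%:R.
Proof. by rewrite coord_free ?(basis_free (vbasisP _)) // eq_sym. Qed.

Fact smooth_coord (s : section Tg) i : (fun m => co i (s m)) \in @smooth_pred _ _ M.
Proof. by apply/asboolP; exact: (sectionP s). Qed.
Definition coord_fun (s : section Tg) i : Cinf := SmoothFun (smooth_coord s i).

Lemma smooth_sum I (r : seq I) (F : I -> M -> R) :
  (forall i, smooth (F i)) -> smooth (fun m => \sum_(i <- r) F i m).
Proof.
move=> hF; elim: r => [|i r IH].
  rewrite (_ : (fun _ => _) = cst 0); first exact: smooth_cst.
  by apply/funext => m; rewrite big_nil.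
rewrite (_ : (fun _ => _) = F i \+ (fun m => \sum_(i <- r) F i m)).
  exact: smoothD.
by apply/funext => m; rewrite big_cons.
Qed.

Fact smooth_const_section (u : g) : smooth_section (v := Tg) (fun=> u).
Proof. by move=> i; exact: smooth_cst. Qed.
Definition const_section (u : g) : section Tg := Section (smooth_const_section u).

(* Derivative of a g-valued function along X, computed in a basis of g. *)
Definition vf_der_fun (X : XM) (s : section Tg) (m : M) : g :=
  \sum_(i < d) X m (coord_fun s i) *: e_`_i.

Lemma co_vf_der X s m i : co i (vf_der_fun X s m) = X m (coord_fun s i).
Proof.
rewrite linear_sum (bigD1 i) //= big1 => [|j ji].
  by rewrite addr0 linearZ /= co_basis eqxx mulr1.
by rewrite linearZ /= co_basis eq_sym (negPf ji) mulr0.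
Qed.

Fact smooth_vf_der X s : smooth_section (v := Tg) (vf_der_fun X s).
Proof.
move=> i; rewrite (_ : (fun _ => _) = (fun m => X m (coord_fun s i))).
  exact: (sectionP X).
by apply/funext => m; exact: co_vf_der.
Qed.
Definition vf_der X s : section Tg := Section (smooth_vf_der X s).

Lemma coord_fun_der X s i : coord_fun (vf_der X s) i = vf_app X (coord_fun s i).
Proof. by apply: smoothfun_ext => m; exact: co_vf_der. Qed.

Definition pw_bracket_fun (s t : section Tg) (m : M) : g := br (s m) (t m).

Lemma co_bracket (u v : g) k :
  co k (br u v) = \sum_(i < d) \sum_(j < d) co i u * co j v * co k (br e_`_i e_`_j).
Proof.
rewrite {1}(coord_vbasis (memvf u)) (lie_suml brP) linear_sum.
apply: eq_bigr => i _; rewrite {1}(coord_vbasis (memvf v)) (lie_sumr brP) linear_sum.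
by apply: eq_bigr => j _; rewrite (lieZl brP) (lieZr brP) !linearZ /= mulrA.
Qed.

Fact smooth_pw_bracket s t : smooth_section (v := Tg) (pw_bracket_fun s t).
Proof.
move=> k; rewrite (_ : (fun _ => _) = (fun m => \sum_(i < d) \sum_(j < d)
   co i (s m) * co j (t m) * co k (br e_`_i e_`_j))); last first.
  by apply/funext => m; exact: co_bracket.
apply: smooth_sum => i; apply: smooth_sum => j.
apply: (@smoothM _ _ M (fun m => co i (s m) * co j (t m)) (cst _)).
  by apply: (@smoothM _ _ M (fun m => co i (s m)) (fun m => co j (t m)));
    [exact: (sectionP s)|exact: (sectionP t)].
exact: smooth_cst.
Qed.
Definition pw_bracket s t : section Tg := Section (smooth_pw_bracket s t).

Lemma smoothfun_sumE I (r : seq I) (F : I -> Cinf) m :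
  (\sum_(i <- r) F i) m = \sum_(i <- r) F i m.
Proof. by elim/big_rec2: _ => // i x y _ <-. Qed.

Lemma coord_fun_bracket s t k :
  coord_fun (pw_bracket s t) k = \sum_(i < d) \sum_(j < d)
    co k (br e_`_i e_`_j) *: (coord_fun s i * coord_fun t j).
Proof.
apply: smoothfun_ext => m; rewrite smoothfun_sumE [LHS]co_bracket.
apply: eq_bigr => i _; rewrite smoothfun_sumE; apply: eq_bigr => j _.
by rewrite smoothfunZ smoothfunM /= mulrC.
Qed.

Lemma coord_fun_lin a s t i :
  coord_fun (a *: s + t) i = a *: coord_fun s i + coord_fun t i.
Proof. by apply: smoothfun_ext => m; exact: (linearP (co i)). Qed.
Lemma coord_fun_mul f s i : coord_fun (section_mul f s) i = f * coord_fun s i.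
Proof. by apply: smoothfun_ext => m; exact: (linearZ_LR (co i)). Qed.

Lemma coP i a (s t : section Tg) m : co i ((a *: s + t) m) = a * co i (s m) + co i (t m).
Proof. exact: (linearP (co i)). Qed.
Lemma coD i (s t : section Tg) m : co i ((s + t) m) = co i (s m) + co i (t m).
Proof. exact: (linearD (co i)). Qed.
Lemma coB i (s t : section Tg) m : co i ((s - t) m) = co i (s m) - co i (t m).
Proof. by rewrite section_subE; exact: (linearB (co i)). Qed.
Lemma coM i f (s : section Tg) m : co i (section_mul f s m) = f m * co i (s m).
Proof. exact: (linearZ_LR (co i)). Qed.

Lemma vf_der_lin X a s t : vf_der X (a *: s + t) = a *: vf_der X s + vf_der X t.
Proof.
apply: section_ext => m; apply: co_ext => i.
by rewrite coP !co_vf_der coord_fun_lin tangentL.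
Qed.
Lemma vf_der_linl a X Y s : vf_der (a *: X + Y) s = a *: vf_der X s + vf_der Y s.
Proof. by apply: section_ext => m; apply: co_ext => i; rewrite coP !co_vf_der. Qed.

Lemma vf_derD X s t : vf_der X (s + t) = vf_der X s + vf_der X t.
Proof. by have := vf_der_lin X 1 s t; rewrite !scale1r. Qed.
Lemma vf_derN X s : vf_der X (- s) = - vf_der X s.
Proof.
have vf_der0 : vf_der X 0 = 0 by apply: (addIr (vf_der X 0)); rewrite -vf_derD !add0r.
by apply: (addIr (vf_der X s)); rewrite -vf_derD !addNr.
Qed.
Lemma vf_derB X s t : vf_der X (s - t) = vf_der X s - vf_der X t.
Proof. by rewrite vf_derD vf_derN. Qed.
Lemma vf_der_mul X f s :
  vf_der X (section_mul f s) = section_mul f (vf_der X s) + section_mul (vf_app X f) s.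
Proof.
apply: section_ext => m; apply: co_ext => i.
by rewrite coD !coM !co_vf_der coord_fun_mul tangentM [in X in _ + X]mulrC.
Qed.
Lemma vf_der_mull X f s : vf_der (section_mul f X) s = section_mul f (vf_der X s).
Proof. by apply: section_ext => m; apply: co_ext => i; rewrite coM !co_vf_der. Qed.
Lemma vf_der_const X u : vf_der X (const_section u) = 0.
Proof.
apply: section_ext => m; apply: co_ext => i; rewrite linear0 co_vf_der.
rewrite (_ : coord_fun _ i = co i u *: (1 : Cinf)); last first.
  by apply: smoothfun_ext => p; rewrite smoothfunZ mulr1.
have X1 := tangentM (X m) 1 1.
rewrite mul1r (_ : (1 : Cinf) m = 1) // mul1r in X1.
by rewrite tangentZ (_ : X m 1 = 0) ?mulr0 //; apply: (addrI (X m 1)); rewrite addr0 -X1.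
Qed.
Lemma vf_der_vf_bracket X Y s :
  vf_der (vf_bracket X Y) s = vf_der X (vf_der Y s) - vf_der Y (vf_der X s).
Proof.
apply: section_ext => m; apply: co_ext => i.
by rewrite coB !co_vf_der !coord_fun_der vf_bracketE.
Qed.
Lemma vf_der_bracket X s t :
  vf_der X (pw_bracket s t) = pw_bracket (vf_der X s) t + pw_bracket s (vf_der X t).
Proof.
apply: section_ext => m; apply: co_ext => k.
rewrite coD co_vf_der coord_fun_bracket tangent_sum.
rewrite [co k (pw_bracket _ t m)]co_bracket [co k (pw_bracket s _ m)]co_bracket.
rewrite -big_split; apply: eq_bigr => i _; rewrite tangent_sum -big_split.
apply: eq_bigr => j _ /=; rewrite tangentZ tangentM !co_vf_der /=; ring.
Qed.

Lemma pw_bracket_lie : is_lie_bracket pw_bracket.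
Proof.
split=> [a s t r|a s t r|s|s t r]; apply: section_ext => m.
- exact: (lie_linearl brP).
- exact: (lie_linearr brP).
- exact: (lie_alt brP).
- exact: (lie_jacobi brP).
Qed.

Local Notation E := (dsum_bundle Tg (tangent_bundle M)).

Definition sec_g (x : section E) : section Tg :=
  @Section _ _ M Tg (fun m => (x m).1) (proj1 (sectionP x)).
Definition sec_t (x : section E) : XM :=
  @Section _ _ M (tangent_bundle M) (fun m => (x m).2) (proj2 (sectionP x)).
Definition sec_pair (s : section Tg) (X : XM) : section E :=
  @Section _ _ M E (fun m => (s m, X m)) (conj (sectionP s) (sectionP X)).

Lemma sec_gK s X : sec_g (sec_pair s X) = s.
Proof. exact: section_ext. Qed.
Lemma sec_tK s X : sec_t (sec_pair s X) = X.
Proof. exact: section_ext. Qed.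
Lemma sec_g_lin a x y : sec_g (a *: x + y) = a *: sec_g x + sec_g y.
Proof. exact: section_ext. Qed.
Lemma sec_t_lin a x y : sec_t (a *: x + y) = a *: sec_t x + sec_t y.
Proof. exact: section_ext. Qed.
Lemma sec_g_mul f x : sec_g (section_mul f x) = section_mul f (sec_g x).
Proof. exact: section_ext. Qed.
Lemma sec_t_mul f x : sec_t (section_mul f x) = section_mul f (sec_t x).
Proof. exact: section_ext. Qed.
Lemma sec_ext x y : sec_g x = sec_g y -> sec_t x = sec_t y -> x = y.
Proof.
move=> gxy txy; apply: section_ext => m.
have := congr1 (fun s : section Tg => s m) gxy.
have := congr1 (fun s : XM => s m) txy.
by rewrite /=; case: (x m) (y m) => [? ?] [? ?] /= -> ->.
Qed.

(* The bracket on all sections of (M x g) + TM; [triv_bracketE] is its value on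
   the sections f u + X and h v + Y, which determines it. *)
Definition triv_bracket (x y : section E) : section E :=
  sec_pair (pw_bracket (sec_g x) (sec_g y) +
            vf_der (sec_t x) (sec_g y) - vf_der (sec_t y) (sec_g x))
           (vf_bracket (sec_t x) (sec_t y)).

Lemma triv_bracketE f u X h v Y :
  triv_bracket (sec_pair (section_mul f (const_section u)) X)
              (sec_pair (section_mul h (const_section v)) Y) =
  sec_pair (section_mul (f * h) (const_section (br u v)) +
            section_mul (vf_app X h) (const_section v) -
            section_mul (vf_app Y f) (const_section u)) (vf_bracket X Y).
Proof.
rewrite /triv_bracket !sec_gK !sec_tK; congr (sec_pair (_ + _ - _) _).
- by apply: section_ext => m; rewrite /= /pw_bracket_fun /= (lieZl brP) (lieZr brP) scalerA.
- rewrite vf_der_mul vf_der_const; apply: section_ext => m.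
  by rewrite /= scaler0 add0r.
- rewrite vf_der_mul vf_der_const; apply: section_ext => m.
  by rewrite /= scaler0 add0r.
Qed.

Lemma sec_g_bracket x y : sec_g (triv_bracket x y) =
  pw_bracket (sec_g x) (sec_g y) +
  vf_der (sec_t x) (sec_g y) - vf_der (sec_t y) (sec_g x).
Proof. exact: sec_gK. Qed.
Lemma sec_t_bracket x y : sec_t (triv_bracket x y) = vf_bracket (sec_t x) (sec_t y).
Proof. exact: sec_tK. Qed.

Lemma sec_gD x y : sec_g (x + y) = sec_g x + sec_g y.
Proof. exact: section_ext. Qed.
Lemma sec_tD x y : sec_t (x + y) = sec_t x + sec_t y.
Proof. exact: section_ext. Qed.
Lemma sec_g0 : sec_g 0 = 0. Proof. exact: section_ext. Qed.
Lemma sec_t0 : sec_t 0 = 0. Proof. exact: section_ext. Qed.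
Lemma coZ i a (s : section Tg) m : co i ((a *: s) m) = a * co i (s m).
Proof. exact: (linearZ_LR (co i)). Qed.
Lemma coN i (s : section Tg) m : co i ((- s) m) = - co i (s m).
Proof. by rewrite section_oppE; exact: (linearN (co i)). Qed.
Lemma co0 i m : co i ((0 : section Tg) m) = 0.
Proof. exact: (linear0 (co i)). Qed.

Lemma triv_bracket_lie : is_lie_bracket triv_bracket.
Proof.
have pwP := pw_bracket_lie; have vfP := @vf_bracket_lie _ _ M.
split=> [a x y z|a x y z|x|x y z]; apply: sec_ext.
- rewrite sec_g_lin !sec_g_bracket !sec_g_lin !sec_t_lin.
  rewrite (lie_linearl pwP) vf_der_linl vf_der_lin.
  apply: section_ext => m; apply: co_ext => i.
  by rewrite !(coB, coD, coZ); ring.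
- by rewrite sec_t_lin !sec_t_bracket sec_t_lin (lie_linearl vfP).
- rewrite sec_g_lin !sec_g_bracket !sec_g_lin !sec_t_lin.
  rewrite (lie_linearr pwP) vf_der_linl vf_der_lin.
  apply: section_ext => m; apply: co_ext => i.
  by rewrite !(coB, coD, coZ); ring.
- by rewrite sec_t_lin !sec_t_bracket sec_t_lin (lie_linearr vfP).
- by rewrite sec_g_bracket (lie_alt pwP) add0r subrr sec_g0.
- by rewrite sec_t_bracket (lie_alt vfP) sec_t0.
- rewrite !sec_gD !sec_g_bracket !sec_t_bracket.
  rewrite !vf_der_vf_bracket !(vf_derD, vf_derN) !vf_der_bracket.
  rewrite !(lieDr pwP, lieNr pwP) ![pw_bracket (vf_der _ _) _](lie_anti pwP).
  have /(canRL (addrK _)) := lie_jacobi pwP (sec_g x) (sec_g y) (sec_g z).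
  move=> /(canRL (addrK _)) ->.
  apply: section_ext => m; apply: co_ext => i; rewrite sec_g0.
  by rewrite !(coB, coD, coN, co0); ring.
- by rewrite !sec_tD !sec_t_bracket (lie_jacobi vfP) sec_t0.
Qed.

Definition triv_anchor : bundle_map E (tangent_bundle M) :=
  dsum_snd Tg (tangent_bundle M).

Lemma triv_anchorE x : bundle_map_section triv_anchor x = sec_t x.
Proof. exact: section_ext. Qed.

Lemma triv_leibniz x f y :
  triv_bracket x (section_mul f y) =
  section_mul f (triv_bracket x y) +
  section_mul (vf_app (bundle_map_section triv_anchor x) f) y.
Proof.
rewrite triv_anchorE; apply: sec_ext.
  rewrite sec_gD !sec_g_mul !sec_g_bracket sec_g_mul sec_t_mul vf_der_mul vf_der_mull.
  apply: section_ext => m; apply: co_ext => i; rewrite !(coB, coD, coM).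
  rewrite (_ : co i (pw_bracket _ (section_mul f _) m) = f m * co i (pw_bracket (sec_g x) (sec_g y) m)).
    by ring.
  by rewrite -coM; congr (co i _); exact: (lieZr brP).
rewrite sec_tD !sec_t_mul !sec_t_bracket sec_t_mul.
apply: section_ext => m; apply: tangent_ext => h.
rewrite section_addE vf_bracketE.
have E1 : vf_app (section_mul f (sec_t y)) h = f * vf_app (sec_t y) h.
  exact: smoothfun_ext.
rewrite E1 tangentM.
transitivity (f m * (sec_t x m (vf_app (sec_t y) h) - sec_t y m (vf_app (sec_t x) h))
  + sec_t x m f * sec_t y m h); last by [].
transitivity (f m * sec_t x m (vf_app (sec_t y) h) + sec_t y m h * sec_t x m f
  - f m * sec_t y m (vf_app (sec_t x) h)); first by [].
by ring.
Qed.

Lemma triv_anchor_bracket x y :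
  bundle_map_section triv_anchor (triv_bracket x y) =
  vf_bracket (bundle_map_section triv_anchor x) (bundle_map_section triv_anchor y).
Proof. by rewrite !triv_anchorE sec_t_bracket. Qed.

Lemma triv_transitive m (v : tangent m) : exists e, triv_anchor m e = v.
Proof. by exists (0, v). Qed.

Definition trivial_lie_algebroid : transitive_lie_algebroid M :=
  TransitiveLieAlgebroid (tla_lie_algebroid :=
    LieAlgebroid triv_bracket_lie triv_leibniz triv_anchor_bracket) triv_transitive.

Fact trivial_ker_subproof (m : M) (u : g) :
  ((u, 0) : E m) \in @ker_pred _ _ _ _ _ triv_anchor m.
Proof. exact: eqxx. Qed.

(* The identification of M x g with the kernel of the anchor. *)
Definition trivial_ker (m : M) (u : g) :
    ker_bundle (la_anchor trivial_lie_algebroid) m :=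
  KerFiber (trivial_ker_subproof m u).

Lemma trivial_ker_surj m (x : ker_bundle (la_anchor trivial_lie_algebroid) m) :
  exists u, x = trivial_ker m u.
Proof.
exists (ker_val x).1; apply: val_inj => /=.
by have /eqP := ker_valP x; rewrite /=; case: (ker_val x) => u v /= ->.
Qed.

End trivial_algebroid.

(* Main.v *)
From HB Require Import structures.
Require Import Defs.
From mathcomp Require Import all_boot all_order all_algebra.
From mathcomp Require Import all_classical all_reals all_analysis.
From mathcomp Require Import ring.
Import GRing.Theory.
Local Open Scope ring_scope.

(** Sections of the kernel of the anchor are g-valued functions s, and the
operator sends s to the pair (B s, phi s), where (phi s)(m) = phi(s(m))(m).
Write D_X for the componentwise derivative of g-valued functions along X.  The
three brackets to which the operator is applied in the Rota-Baxter identity for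
s and t lie in the kernel, and they add up to
  w = [s, t]_B + D_(phi s) t - D_(phi t) s                    ([rb_argument]),
with [s, t]_B computed pointwise.  It remains to compare the operator at w with
the bracket of (B s, phi s) and (B t, phi t).

In the g-component this is the pointwise Rota-Baxter identity for B together
with D_X (B t) = B (D_X t)                                   ([vf_der_map]).
In the TM-component it is
  [phi s, phi t] = phi (D_(phi s) t) - phi (D_(phi t) s) + phi [s, t]_B.
At the point m, the vector field phi t varies for two reasons: t varies, and
the constant-coefficient field phi(t(m)) varies.  The first gives the two
derivative terms, the second gives [phi(s(m)), phi(t(m))], which is
phi([s(m), t(m)]_B) since phi is an action  ([action_section_bracket]).

Both facts on derivatives are instances of one product rule, [vf_pairing], for
the function m |-> L(t(m))(m) attached to a linear map L from g to C^oo(M): the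
first has L u a constant function (a coordinate of B u), the second has
L u = phi(u)(f) for a fixed function f. *)

(** * Pairing a g-valued function with a linear map from g to functions *)

Section varying_functional.
Context {R : realType} {n : nat} {M : manifold R n} {g : vectType R}.
Local Notation Cinf := (smoothfun M).
Local Notation XM := (section (tangent_bundle M)).
Local Notation Tg := (trivial_bundle M g).
Local Notation e_ := (vbasis (fullv : {vspace g})).
Local Notation co := (coord (vbasis (fullv : {vspace g}))).
Implicit Types (L : {linear g -> Cinf}) (t : section Tg) (X : XM).

(** Linearity of L reduces the pairing, which depends on m twice, to a finite
sum of products of smooth functions. *)
Lemma pairing_coord L t m :
  L (t m) m = (\sum_i coord_fun t i * L e_`_i) m.
Proof.
rewrite {1}(coord_vbasis (memvf (t m))) linear_sum !smoothfun_sumE.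
by apply: eq_bigr => i _; rewrite linearZ.
Qed.

Fact pairing_subproof L t : (fun m => L (t m) m) \in @smooth_pred _ _ M.
Proof.
have -> : (fun m => L (t m) m) = smoothfun_val (\sum_i coord_fun t i * L e_`_i).
  by apply/funext => m; exact: pairing_coord.
exact: smoothfunP.
Qed.

Definition pairing L t : Cinf := SmoothFun (pairing_subproof L t).

(** The Leibniz rule: m enters through t, whose derivative is paired with L,
and through the functions L u with u frozen at t(m). *)
Lemma vf_pairing L X t m :
  X m (pairing L t) = L (vf_der X t m) m + X m (L (t m)).
Proof.
have -> : pairing L t = \sum_i coord_fun t i * L e_`_i.
  by apply: smoothfun_ext => p; exact: pairing_coord.
rewrite [L (vf_der X t m) m]pairing_coord.
rewrite [in X in _ = _ + X](coord_vbasis (memvf (t m))) linear_sum.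
rewrite smoothfun_sumE !tangent_sum -big_split; apply: eq_bigr => i _.
rewrite linearZ tangentM tangentZ coord_fun_der smoothfunM /=; ring.
Qed.

Lemma tangent_cst (m : M) (v : tangent m) (a : R) : v (smoothfun_cst M a) = 0.
Proof.
have -> : smoothfun_cst M a = a *: (1 : smoothfun M).
  by apply: smoothfun_ext => p; rewrite smoothfunZ mulr1.
have v1 : v (1 * 1) = 1 * v 1 + 1 * v 1 := tangentM v 1 1.
rewrite !mul1r in v1; rewrite tangentZ (_ : v 1 = 0) ?mulr0 //.
by apply: (addrI (v 1)); rewrite addr0 -v1.
Qed.

End varying_functional.

(** * Composition with a fixed linear endomorphism *)

Section constant_map.
Context {R : realType} {n : nat} {M : manifold R n} {g : vectType R}.
Variable B : {linear g -> g}.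
Local Notation Tg := (trivial_bundle M g).
Local Notation d := (\dim (fullv : {vspace g})).
Local Notation co := (coord (vbasis (fullv : {vspace g}))).

(** The coordinates of B u are viewed as constant functions on M so that the
pairing of [coord_map i] with s is the i-th coordinate of B s. *)
Definition coord_map (i : 'I_d) (u : g) : smoothfun M :=
  smoothfun_cst M (co i (B u)).

Fact coord_map_linear i : linear (coord_map i).
Proof.
by move=> a u v; apply: smoothfun_ext => m; rewrite /= linearP linearP.
Qed.

HB.instance Definition _ i :=
  GRing.isLinear.Build R g (smoothfun M) *:%R (coord_map i) (coord_map_linear i).

Fact map_section_subproof (s : section Tg) :
  smooth_section (v := Tg) (fun m => B (s m)).
Proof. by move=> i; apply/asboolP; exact: (smoothfunP (pairing (coord_map i) s)). Qed.

Definition map_section (s : section Tg) : section Tg :=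
  Section (map_section_subproof s).

(** Only s contributes to the product rule, the paired functions being
constant. *)
Lemma vf_der_map X s m : vf_der X (map_section s) m = B (vf_der X s m).
Proof.
apply: co_ext => i; rewrite co_vf_der.
have -> : coord_fun (map_section s) i = pairing (coord_map i) s.
  exact: smoothfun_ext.
by rewrite vf_pairing tangent_cst addr0.
Qed.

End constant_map.

(** * The vector field attached to a g-valued function *)

Section action.
Context {R : realType} {n : nat} {M : manifold R n} {g : vectType R}.
Local Notation XM := (section (tangent_bundle M)).
Local Notation Tg := (trivial_bundle M g).
Variable phi : {linear g -> XM}.

Definition action_app (f : smoothfun M) (u : g) : smoothfun M :=
  vf_app (phi u) f.

Fact action_app_linear f : linear (action_app f).
Proof. by move=> a u v; rewrite /action_app linearP vf_app_lin. Qed.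

HB.instance Definition _ f :=
  GRing.isLinear.Build R g (smoothfun M) *:%R (action_app f) (action_app_linear f).

Fact action_section_subproof (s : section Tg) :
  smooth_section (v := tangent_bundle M) (fun m => phi (s m) m).
Proof. by move=> f; apply/asboolP; exact: (smoothfunP (pairing (action_app f) s)). Qed.

Definition action_section (s : section Tg) : XM :=
  Section (action_section_subproof s).

Lemma action_lin a u v m : phi (a *: u + v) m = a *: phi u m + phi v m.
Proof. by rewrite linearP. Qed.

Lemma actionD u v m : phi (u + v) m = phi u m + phi v m.
Proof. by rewrite linearD. Qed.

Lemma actionB u v m : phi (u - v) m = phi u m - phi v m.
Proof. by rewrite linearB section_subE. Qed.

(** Applying the field of s to the function obtained from the field of t gives,
by the product rule, a term with t differentiated and a term with t frozen at
its value t(m); the frozen terms recombine into a bracket of two fields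
coming from g. *)
Lemma action_section_bracket s t m :
  vf_bracket (action_section s) (action_section t) m =
  vf_bracket (phi (s m)) (phi (t m)) m +
  phi (vf_der (action_section s) t m) m - phi (vf_der (action_section t) s m) m.
Proof.
apply: tangent_ext => f; rewrite vf_bracketE.
have appE r : vf_app (action_section r) f = pairing (action_app f) r.
  exact: smoothfun_ext.
rewrite !appE !vf_pairing.
transitivity (phi (s m) m (vf_app (phi (t m)) f) - phi (t m) m (vf_app (phi (s m)) f)
  + phi (vf_der (action_section s) t m) m f - phi (vf_der (action_section t) s m) m f);
  last by [].
rewrite /=; ring.
Qed.

End action.

(** * The operator on the kernel of the anchor *)

Section operator.
Context {R : realType} {n : nat} {M : manifold R n} {g : vectType R}.
Context {br : g -> g -> g} (brP : is_lie_bracket br).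
Variables (B : {linear g -> g}) (phi : {linear g -> section (tangent_bundle M)}).
Local Notation A := (trivial_lie_algebroid M brP).
Local Notation K := (ker_bundle (la_anchor A)).
Local Notation Tg := (trivial_bundle M g).

Definition rb_fun (m : M) (x : K m) : A m :=
  (B (ker_val x).1, phi (ker_val x).1 m).

Fact rb_fun_linear m : linear (rb_fun m).
Proof.
move=> a x y; by rewrite /rb_fun /= action_lin linearP.
Qed.

HB.instance Definition _ m :=
  GRing.isLinear.Build R (K m) (A m) *:%R (rb_fun m) (rb_fun_linear m).

Definition ker_g (u : section K) : section Tg := sec_g (ker_incl u).

Fact rb_fun_smooth (s : forall m, K m) :
  smooth_section s -> smooth_section (fun m => rb_fun m (s m)).
Proof.
move=> hs; have := sectionP (sec_pair (map_section B (ker_g (Section hs)))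
  (action_section phi (ker_g (Section hs)))).
exact.
Qed.

Definition rb_map : bundle_map K A := BundleMap rb_fun_smooth.
Local Notation Bs := (bundle_map_section rb_map).

Lemma sec_g_rb u : sec_g (Bs u) = map_section B (ker_g u).
Proof. exact: section_ext. Qed.

Lemma sec_t_rb u : sec_t (Bs u) = action_section phi (ker_g u).
Proof. exact: section_ext. Qed.

Lemma sec_t_ker (u : section K) : sec_t (ker_incl u) = 0.
Proof. by rewrite -triv_anchorE ker_incl0. Qed.

Lemma vf_der0l (s : section Tg) : vf_der 0 s = 0.
Proof. by apply: section_ext => m; apply: co_ext => i; rewrite co_vf_der co0. Qed.

(** Sections of the kernel have no TM-component, so each of the two mixed
brackets keeps just one derivative term. *)
Lemma rb_argument (u v : section K) m :
  ker_g (ker_bracketl (Bs u) v) m + ker_g (ker_bracketr u (Bs v)) m +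
    ker_g (ker_bracketl (ker_incl u) v) m =
  rb_bracket br B (ker_g u m) (ker_g v m) +
    vf_der (action_section phi (ker_g u)) (ker_g v) m -
    vf_der (action_section phi (ker_g v)) (ker_g u) m.
Proof.
have gl x w : ker_g (ker_bracketl x w) = sec_g (triv_bracket brP x (ker_incl w)).
  exact: section_ext.
have gr w x : ker_g (ker_bracketr w x) = sec_g (triv_bracket brP (ker_incl w) x).
  exact: section_ext.
rewrite !gl gr !sec_g_bracket !sec_t_ker !sec_g_rb !sec_t_rb !vf_der0l.
rewrite !section_subE !section_addE /= /pw_bracket_fun /rb_bracket /= !subr0 !addr0.
by rewrite addrACA [LHS]addrAC !addrA.
Qed.

End operator.

Theorem proposition4p9 (R : realType) (n : nat) (M : manifold R n)
    (g : vectType R) (br : g -> g -> g) (brP : is_lie_bracket br)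
    (B : {linear g -> g}) (BP : is_rota_baxter br B)
    (phi : {linear g -> section (tangent_bundle M)})
    (phiP : is_lie_morphism (rb_bracket br B) vf_bracket phi) :
  let A := trivial_lie_algebroid M brP in
  exists BB : bundle_map (ker_bundle (la_anchor A)) A,
    (forall (m : M) (u : g), BB m (trivial_ker brP m u) = (B u, phi u m)) /\
    is_rota_baxter_operator 1 BB.
Proof.
exists (rb_map brP B phi); split=> // u v Bs; rewrite scale1r; apply: sec_ext.
- rewrite [LHS]sec_g_bracket !sec_gD !sec_g_rb !sec_t_rb; apply: section_ext => m.
  rewrite section_subE !section_addE !vf_der_map /= /pw_bracket_fun /=.
  by rewrite BP -!linearD rb_argument linearB linearD.
- rewrite [LHS]sec_t_bracket !sec_tD !sec_t_rb; apply: section_ext => m.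
  rewrite action_section_bracket !section_addE /= -!actionD rb_argument actionB actionD.
  by rewrite phiP.
Qed.
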